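(* Let $P$ be a $k$-simple $d$-polytope with $1\le k\le d-1$. Then $P$ is inscribed if and only if all its $(d-k+1)$-dimensional faces are inscribed.
   Context: A $d$-polytope is $k$-simple if every $(d-k-1)$-dimensional face is contained in exactly $k+1$ facets. A polytope (or face) is inscribed if all its vertices lie on a common sphere. *)

(* Defs.v *)
From HB Require Import structures.
From mathcomp Require Import all_boot all_order all_algebra.
Set Implicit Arguments. Unset Strict Implicit. Unset Printing Implicit Defensive.
Import Order.TTheory GRing.Theory Num.Theory.
Local Open Scope ring_scope.

Section Polytopes.
Variables (R : realFieldType) (d : nat).

Definition pset := 'rV[R]_d -> Prop.

Definition dot (u v : 'rV[R]_d) : R := \sum_(i < d) u ord0 i * v ord0 i.

Definition conv (V : seq 'rV[R]_d) : pset := fun x =>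
  exists w : 'I_(size V) -> R,
    [/\ forall i, 0 <= w i, \sum_i w i = 1 & x = \sum_i w i *: V`_i].

Definition extreme (S : pset) (x : 'rV[R]_d) : Prop :=
  S x /\ forall y z (t : R), S y -> S z -> 0 < t -> t < 1 ->
    x = t *: y + (1 - t) *: z -> y = z.

Definition aff_indep (s : seq 'rV[R]_d) : bool :=
  if s is p0 :: t then free [seq p - p0 | p <- t] else true.

Definition has_dim (S : pset) (n : nat) : Prop :=
  (exists s : seq 'rV[R]_d, [/\ size s = n.+1, forall x, x \in s -> S x & aff_indep s])
  /\ (forall s : seq 'rV[R]_d, (forall x, x \in s -> S x) -> aff_indep s -> (size s <= n.+1)%N).

(* F is a face of P: intersection of P with a valid supporting hyperplane
   (includes P itself and the empty face) *)
Definition face (P F : pset) : Prop :=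
  exists (a : 'rV[R]_d) (b : R),
    (forall x, P x -> dot a x <= b) /\ (forall x, F x <-> (P x /\ dot a x = b)).

Definition facet (P G : pset) : Prop := face P G /\ has_dim G d.-1.

Definition k_simple (P : pset) (k : nat) : Prop :=
  forall F, face P F -> has_dim F (d - k - 1) ->
    exists f : 'I_k.+1 -> pset,
      [/\ forall i j, (forall x, f i x <-> f j x) -> i = j,
          forall i, facet P (f i) /\ (forall x, F x -> f i x)
        & forall G, facet P G -> (forall x, F x -> G x) ->
            exists i, forall x, G x <-> f i x].

Definition inscribed (S : pset) : Prop :=
  exists (c : 'rV[R]_d) (r : R), 0 < r /\
    forall v, extreme S v -> dot (v - c) (v - c) = r.

End Polytopes.

(* Main.v *)
(* On the sphere |v - c|^2 = r the function q(v) = |v|^2 is affine, and conversely,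
   so a face is inscribed iff q agrees with an affine function on its vertices.
   Let S be a face of dimension d-k-1.  Its k+1 facets are linearly independent and
   cut out a Boolean interval above S, so the affine functions given by the
   (d-k+1)-faces above S glue to a single one l_S.  Two (d-k-1)-faces S, S' in a
   common (d-k)-face E satisfy l_S = l_S', because the (d-k+1)-faces containing E
   already determine an affine function.  The (d-k-1)-faces are connected through
   (d-k)-faces: an edge-following argument as in the simplex method, in the quotient
   by a common face, by descending induction on that face. *)
Require Import Defs.
From HB Require Import structures.
From mathcomp Require Import all_boot all_order all_algebra.
From mathcomp Require Import ring lra zify.
Set Implicit Arguments. Unset Strict Implicit. Unset Printing Implicit Defensive.
Import Order.TTheory GRing.Theory Num.Theory.
Local Open Scope ring_scope.

(** * Faces as zero sets of nonnegative vectors *)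

(** All geometry is moved to index sets of listed points and to the row space of the matrix of
    values of affine functions, where dimension becomes a rank. Listed points may repeat or fail to
    be vertices, so identities are tested at vertices and then extended to whole faces. The field is
    merely ordered, so no compactness is available: every extremal choice is a ratio test over
    finitely many columns or facets. The dimension d-k+1 comes from counting facets. A (d-k+1)-face
    above S lies in all but two of the k+1 facets through S. Choose for each of these facets a
    vertex off it and on all the others: any two of these vertices share a (d-k+1)-face with S, and
    together with the values on S the values at all of them determine an affine function. *)

Section FaceLattice.

(* The columns of [A] are the points; a linear functional is represented by the row
   vector of its values on them, so functionals are the elements of the row space
   of [A], and a face is the set of columns where a nonnegative one vanishes. *)

Variables (R : realFieldType) (n m : nat) (A : 'M[R]_(n, m)).
Implicit Types (y z a b h f : 'rV[R]_m) (S T G : {set 'I_m}) (j u : 'I_m).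

Definition valid y := (y <= A)%MS && [forall j, 0 <= y 0 j].
Definition zeros y := [set j | y 0 j == 0].
Definition is_face S := exists2 a, valid a & zeros a = S.
Definition indicator S : 'M[R]_m := diag_mx (\row_j (j \in S)%:R).
Definition ann S := (A :&: kermx (indicator S))%MS.
(** For the points of a d-polytope of full dimension, a face of dimension r gets the value d - r and
    the empty face gets d + 1. *)
Definition codim S := \rank (ann S).

Lemma validP y : reflect ((y <= A)%MS /\ forall j, 0 <= y 0 j) (valid y).
Proof. by apply: (iffP andP) => -[yA /forallP]. Qed.

Lemma annP S y :
  reflect ((y <= A)%MS /\ forall j, j \in S -> y 0 j = 0) (y <= ann S)%MS.
Proof.
rewrite sub_capmx; apply: (iffP andP) => -[yA].
  move/sub_kermxP/rowP => y0; split=> // j jS; move: (y0 j).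
  by rewrite mul_mx_diag !mxE jS mulr1.
move=> y0; split=> //; apply/sub_kermxP/rowP => j.
rewrite mul_mx_diag !mxE.
by have [/y0 -> | _] := boolP (j \in S); rewrite ?mul0r ?mulr0.
Qed.

Lemma annS S T : S \subset T -> (ann T <= ann S)%MS.
Proof.
move=> /subsetP sST; apply/rV_subP => y /annP[yA y0].
by apply/annP; split=> // j /sST /y0.
Qed.

Lemma codimS S T : S \subset T -> (codim T <= codim S)%N.
Proof. by move=> /annS; apply: mxrankS. Qed.

Lemma valid_ann y : valid y -> (y <= ann (zeros y))%MS.
Proof. by case/validP=> yA _; apply/annP; split=> // j; rewrite inE => /eqP. Qed.

Lemma notin_zeros y j : valid y -> (j \notin zeros y) = (0 < y 0 j).
Proof. by case/validP=> _ y0; rewrite inE lt0r y0 andbT. Qed.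

Lemma valid0 : valid 0.
Proof. by apply/validP; split=> [|j]; rewrite ?sub0mx ?mxE. Qed.

Lemma validD y z : valid y -> valid z -> valid (y + z).
Proof.
case/validP=> yA y0 /validP[zA z0]; apply/validP; split; first exact: addmx_sub.
by move=> j; rewrite mxE addr_ge0.
Qed.

Lemma validZ t y : 0 <= t -> valid y -> valid (t *: y).
Proof.
move=> t0 /validP[yA y0]; apply/validP; split; first exact: scalemx_sub.
by move=> j; rewrite mxE mulr_ge0.
Qed.

Lemma zerosD y z : valid y -> valid z -> zeros (y + z) = zeros y :&: zeros z.
Proof.
case/validP=> _ y0 /validP[_ z0]; apply/setP => j.
by rewrite !inE mxE paddr_eq0.
Qed.

Lemma zerosZ t y : t != 0 -> zeros (t *: y) = zeros y.
Proof. by move=> t0; apply/setP => j; rewrite !inE mxE mulf_eq0 (negPf t0). Qed.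

Lemma zeros_subset_ann S y : (y <= ann S)%MS -> S \subset zeros y.
Proof. by case/annP=> _ y0; apply/subsetP => j /y0; rewrite inE => ->. Qed.

Lemma valid_sum I (r : seq I) (P : pred I) (F : I -> 'rV_m) :
  (forall i, P i -> valid (F i)) -> valid (\sum_(i <- r | P i) F i).
Proof. by move=> vF; apply: (big_ind valid) => //; [exact: valid0 | exact: validD]. Qed.

Lemma zeros_sum (I : finType) (P : pred I) (F : I -> 'rV_m) j :
  (forall i, P i -> valid (F i)) ->
  (j \in zeros (\sum_(i | P i) F i)) = [forall (i | P i), j \in zeros (F i)].
Proof.
move=> vF; rewrite inE summxE psumr_eq0; last first.
  by move=> i /vF /validP[].
rewrite -big_all big_andE; apply: eq_forallb => i; rewrite inE.
by case: (P i).
Qed.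

(** * The ratio test *)

Lemma ratio_min a y T : ~~ (T \subset zeros a) -> valid a ->
  exists mu u, [/\ u \in T, u \notin zeros a, y 0 u = mu * a 0 u &
    forall j, j \in T -> j \notin zeros a -> mu * a 0 j <= y 0 j].
Proof.
move=> /subsetPn[i iT ia] va.
pose P j := (j \in T) && (j \notin zeros a).
have Pi : P i by rewrite /P iT.
case: (arg_minP (fun j => y 0 j / a 0 j) Pi) => u /andP[uT ua] min_u.
exists (y 0 u / a 0 u), u; split=> //.
  by rewrite divfK //; move: ua; rewrite inE.
move=> j jT ja; rewrite -ler_pdivlMr -?notin_zeros //.
by apply: min_u; rewrite /P jT.
Qed.

Lemma ratio_min_ann a y T :
    ~~ (T \subset zeros a) -> valid a -> (y <= ann (zeros a))%MS ->
  exists mu u, [/\ u \in T, u \notin zeros a, y 0 u = mu * a 0 u &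
    forall j, j \in T -> mu * a 0 j <= y 0 j].
Proof.
move=> nTa va /annP[yA y0].
have [mu [u [uT ua yu min_u]]] := ratio_min y nTa va.
exists mu, u; split=> // j jT.
have [ja|] := boolP (j \in zeros a); last exact: min_u.
by rewrite y0 //; move: ja; rewrite inE => /eqP ->; rewrite mulr0.
Qed.

Lemma dominate a y : valid a ->
  exists2 M, 0 < M & forall j, j \notin zeros a -> 0 < M * a 0 j + y 0 j.
Proof.
move=> va; have [Ta | nTa] := boolP ([set: 'I_m] \subset zeros a).
  by exists 1 => // j; rewrite (subsetP Ta) // in_setT.
have [mu [u [_ _ _ min_u]]] := ratio_min y nTa va.
exists (1 + `|mu|); first by have := normr_ge0 mu; lra.
move=> j ja; have := min_u j (in_setT _) ja.
have := ler_norm (- mu); rewrite normrN; move: ja; rewrite notin_zeros //.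
nra.
Qed.

(** The valid vectors with zero set [zeros a] are open in the annihilator of that set, hence span
    it; this later turns nonnegative combinations into linear ones. *)
Lemma dominate_ann a y : valid a -> (y <= ann (zeros a))%MS ->
  exists2 M, 0 < M & valid (M *: a + y) /\ zeros (M *: a + y) = zeros a.
Proof.
move=> va /annP[yA y0]; have [M M0 dom] := dominate y va.
exists M => //.
have E j : j \in zeros a -> (M *: a + y) 0 j = 0.
  by move=> ja; rewrite !mxE y0 //; move: ja; rewrite inE => /eqP ->; rewrite mulr0 addr0.
have L j : j \notin zeros a -> 0 < (M *: a + y) 0 j.
  by move=> /dom; rewrite !mxE.
split.
  apply/validP; split; first by rewrite addmx_sub // scalemx_sub //; case/validP: va.
  by move=> j; have [/E -> | /L /ltW] := boolP (j \in zeros a).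
apply/setP => j; rewrite [LHS]inE.
by have [/E -> | /L /gt_eqF ->] := boolP (j \in zeros a); rewrite ?eqxx.
Qed.

(** Adding a large multiple of a functional defining [S] makes [y] positive off [S] and leaves it
    unchanged on [S]. *)
Lemma face_of_face S y : is_face S -> (y <= A)%MS ->
  (forall j, j \in S -> 0 <= y 0 j) -> is_face (S :&: zeros y).
Proof.
move=> [a va <-] yA y0; have [M M0 dom] := dominate y va.
have E j : j \in zeros a -> (M *: a + y) 0 j = y 0 j.
  by rewrite !mxE inE => /eqP ->; rewrite mulr0 add0r.
have L j : j \notin zeros a -> 0 < (M *: a + y) 0 j.
  by move=> /dom; rewrite !mxE.
exists (M *: a + y).
  apply/validP; split; first by rewrite addmx_sub // scalemx_sub //; case/validP: va.
  move=> j; have [ja | /L /ltW //] := boolP (j \in zeros a).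
  by rewrite E // y0.
apply/setP => j; rewrite [LHS]inE in_setI.
by have [ja | /L /gt_eqF ->] := boolP (j \in zeros a); rewrite ?E //= inE.
Qed.

(** * Grading of the face lattice by codimension *)

Lemma codim_lt G T : is_face G -> G \proper T -> (codim T < codim G)%N.
Proof.
move=> [a va zaG] /properP[sGT [j jT jG]]; apply: rank_ltmx.
rewrite ltmxE annS //=; apply/negP => sTG.
have aG : (a <= ann G)%MS by rewrite -zaG valid_ann.
have /annP[_ /(_ j jT) aj] := submx_trans aG sTG.
by move: jG; rewrite -zaG inE aj eqxx.
Qed.

Lemma face_eq G T : is_face G -> G \subset T -> codim G = codim T -> G = T.
Proof.
move=> fG sGT eGT; apply/eqP; rewrite eqEproper sGT /=; apply/negP => pGT.
by have := codim_lt fG pGT; rewrite eGT ltnn.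
Qed.

Lemma face_setT : is_face [set: 'I_m].
Proof. by exists 0; [exact: valid0 | apply/setP => j; rewrite !inE mxE eqxx]. Qed.

Lemma codim_setT : codim [set: 'I_m] = 0%N.
Proof.
apply/eqP; rewrite mxrank_eq0 -submx0; apply/rV_subP => y /annP[_ y0].
suff -> : y = 0 by exact: sub0mx.
by apply/rowP => j; rewrite y0 ?in_setT // mxE.
Qed.

(** If the codimension drops by more than one, some [b] in [ann G] lies outside [ann T + a]. Tilting
    [- b] by a multiple of [a] until it is nonnegative on [T] with a zero off [G] cuts out a face
    strictly between, which replaces [T]. *)
Lemma face_between G T : is_face G -> is_face T -> G \proper T ->
  exists G', [/\ is_face G', G \subset G', G' \subset T & codim G = (codim G').+1].
Proof.
move=> fG; have [k le_k] := ubnP #|T|; elim: k => // k IHk in T le_k *.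
move=> fT pGT; have := codim_lt fG pGT; rewrite leq_eqVlt => /orP[/eqP eGT | lt2].
  by exists T; split=> //; exact: proper_sub.
have [a va za] := fG; have aG : (a <= ann G)%MS by rewrite -za valid_ann.
have : ~~ (ann G <= ann T + a)%MS.
  apply/negP => /mxrankS; rewrite leqNgt => /negP; apply.
  apply: leq_trans lt2; rewrite ltnS (leq_trans (mxrank_adds_leqif _ _).1) //.
  by rewrite -[(codim T).+1]addn1 leq_add2l rank_leq_row.
case/row_subPn => i; move: (row i _) (row_sub i (ann G)) => b bG nb.
have nTa : ~~ (T \subset zeros a) by rewrite za; move: pGT; rewrite properE => /andP[].
have nbG : (- b <= ann (zeros a))%MS by rewrite za eqmx_opp.
have [mu [u [uT ua yu min_u]]] := ratio_min_ann nTa va nbG.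
pose y := - b - mu *: a.
have yG : (y <= ann G)%MS by rewrite addmx_sub ?eqmx_opp // scalemx_sub.
have yA : (y <= A)%MS by case/annP: yG.
have fT' : is_face (T :&: zeros y).
  by apply: face_of_face => // j jT; have := min_u j jT; rewrite !mxE; lra.
have sGT' : G \subset T :&: zeros y.
  by rewrite subsetI proper_sub // zeros_subset_ann.
have uT' : u \in T :&: zeros y.
  by rewrite in_setI uT inE; apply/eqP; move: yu; rewrite !mxE; lra.
have pT' : T :&: zeros y \proper T.
  rewrite properE subsetIl; apply/negP; rewrite subsetI subxx /= => sTy.
  case/negP: nb; have -> : b = - y - mu *: a by rewrite /y; apply/rowP=> j; rewrite !mxE; ring.
  rewrite addmx_sub_adds ?eqmx_opp ?scalemx_sub //.
  by apply/annP; split=> // j /(subsetP sTy); rewrite inE => /eqP.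
have pGT' : G \proper T :&: zeros y.
  by apply/properP; split=> //; exists u => //; rewrite -za.
have [|G' [fG' sGG' sG'T' cG']] := IHk _ _ fT' pGT'.
  by apply: leq_trans (proper_card pT') _; rewrite -ltnS.
by exists G'; split=> //; apply: subset_trans sG'T' (subsetIl _ _).
Qed.

Lemma face_of_codim G c : is_face G -> (c <= codim G)%N ->
  exists S, [/\ is_face S, G \subset S & codim S = c].
Proof.
have [k le_k] := ubnP (codim G); elim: k => // k IHk in G le_k *.
move=> fG; rewrite leq_eqVlt => /orP[/eqP -> | lt_c]; first by exists G.
have pGT : G \proper [set: 'I_m].
  rewrite properEneq subsetT andbT; apply/eqP => GT.
  by move: lt_c; rewrite GT codim_setT.
have [G' [fG' sGG' _ cG']] := face_between fG face_setT pGT.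
have [||S [fS sG'S cS]] := IHk G' _ fG'; try by rewrite cG' in le_k lt_c.
by exists S; split=> //; apply: subset_trans sG'S.
Qed.

Lemma improving_face a y j0 :
    valid a -> (y <= ann (zeros a))%MS -> y 0 j0 < 0 ->
  exists G t, [/\ is_face G, zeros a \subset G, codim (zeros a) = (codim G).+1,
                  0 < t & forall j, j \in G -> y 0 j = - t * a 0 j].
Proof.
move=> va ya yj0; have [yA y0] := annP _ _ ya.
have j0a : j0 \notin zeros a by apply/negP => /y0 E; rewrite E ltxx in yj0.
have nTa : ~~ ([set: 'I_m] \subset zeros a) by apply/subsetPn; exists j0.
have [mu [u [_ ua yu min_u]]] := ratio_min_ann nTa va ya.
have vz : valid (y - mu *: a).
  apply/validP; split=> [|j].
    by rewrite addmx_sub ?eqmx_opp // scalemx_sub //; case/validP: va.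
  by have := min_u j (in_setT _); rewrite !mxE; lra.
have sz : zeros a \subset zeros (y - mu *: a).
  apply: zeros_subset_ann.
  by rewrite addmx_sub ?eqmx_opp // scalemx_sub // valid_ann.
have [G [fG sG sGz cG]] : exists G, [/\ is_face G, zeros a \subset G,
    G \subset zeros (y - mu *: a) & codim (zeros a) = (codim G).+1].
  apply: face_between; [by exists a | by exists (y - mu *: a) |].
  apply/properP; split=> //; exists u => //; rewrite inE !mxE yu.
  by rewrite subrr.
exists G, (- mu); split=> //.
  have := min_u j0 (in_setT _); move: j0a; rewrite notin_zeros //; nra.
move=> j /(subsetP sGz); rewrite inE !mxE => /eqP; lra.
Qed.

(** The quotient of [ann G] by [ann T] is a line, spanned by the class of [h]. *)
Lemma ann_ratio G T h f : codim G = (codim T).+1 -> G \subset T ->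
    (h <= ann G)%MS -> ~~ (h <= ann T)%MS -> (f <= ann G)%MS ->
  exists phi, forall j, j \in T -> f 0 j = phi * h 0 j.
Proof.
move=> cG sGT hG hT fG.
have sub : (ann T + h <= ann G)%MS by rewrite addsmx_sub annS.
have lt : (codim T < \rank (ann T + h))%N.
  apply: rank_ltmx; rewrite ltmxE addsmxSl /=; apply: contra hT.
  by apply: submx_trans; rewrite addsmxSr.
have : (ann G <= ann T + h)%MS.
  by rewrite -(mxrank_leqif_sup sub).2 eqn_leq mxrankS //= -/(codim G) cG.
move=> /(submx_trans fG) /sub_addsmxP[[v c] /= ->].
exists (c 0 0) => j jT; rewrite !mxE.
have /annP[_ /(_ j jT)] : (v *m ann T <= ann T)%MS by rewrite submxMl.
by rewrite mxE => ->; rewrite add0r big_ord1.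
Qed.

(** The diamond property: an interval of length two has a second middle face. It is the locus in [T]
    where [a / h] takes its largest value [M]; as [M] is positive, it differs from [zeros a]. *)
Lemma opposite_face G T a h : valid a -> valid h -> zeros h = G ->
    G \subset zeros a -> zeros a \subset T -> is_face T ->
    codim G = (codim (zeros a)).+1 -> codim (zeros a) = (codim T).+1 ->
  exists G' M, [/\ is_face G', G \subset G', G' \subset T, codim G = (codim G').+1 &
    0 < M /\ forall j, j \in G' -> a 0 j = M * h 0 j].
Proof.
move=> va vh zh sGa saT fT cG ca.
have [j1 j1a j1G] : exists2 j, j \in zeros a & j \notin G.
  apply/subsetPn; apply/negP => /codimS; rewrite cG ltnn //.
have [j2 j2T j2a] : exists2 j, j \in T & j \notin zeros a.
  apply/subsetPn; apply/negP => /codimS; rewrite ca ltnn //.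
have nTh : ~~ (T \subset zeros h).
  by rewrite zh; apply/subsetPn; exists j1 => //; apply: (subsetP saT).
have aG : (- a <= ann (zeros h))%MS.
  by rewrite zh eqmx_opp; apply: submx_trans (annS sGa); apply: valid_ann.
have [mu [u [uT uh yu min_u]]] := ratio_min_ann nTh vh aG.
have mu0 : mu < 0.
  have := min_u _ j2T; move: j2a; rewrite notin_zeros // !mxE.
  have /validP[_ /(_ j2)] := vh; nra.
pose y := - a - mu *: h.
have yG : (y <= ann (zeros h))%MS.
  by rewrite addmx_sub // eqmx_opp scalemx_sub // valid_ann.
have fT' : is_face (T :&: zeros y).
  apply: face_of_face => //; first by case/annP: yG.
  by move=> j jT; have := min_u j jT; rewrite !mxE; lra.
have lt1 : (codim (T :&: zeros y) < codim G)%N.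
  apply: codim_lt; first by exists h.
  apply/properP; split; last first.
    exists u; last by rewrite -zh.
    by rewrite in_setI uT inE; apply/eqP; move: yu; rewrite !mxE; lra.
  rewrite subsetI (subset_trans sGa saT) -zh zeros_subset_ann //.
have lt2 : (codim T < codim (T :&: zeros y))%N.
  apply: codim_lt => //; apply/properP; split; first exact: subsetIl.
  exists j1; first exact: (subsetP saT).
  rewrite in_setI (subsetP saT) //= inE !mxE.
  move: j1a; rewrite inE => /eqP ->; rewrite oppr0 add0r oppr_eq0 mulf_eq0.
  rewrite (lt_eqF mu0) /=; move: j1G; rewrite -zh inE //.
exists (T :&: zeros y), (- mu); split=> //.
- by rewrite subsetI (subset_trans sGa saT) -zh zeros_subset_ann.
- exact: subsetIl.
- by apply/eqP; rewrite eqn_leq lt1 andbT cG ca.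
split; first lra.
by move=> j; rewrite in_setI !inE !mxE => /andP[_ /eqP]; lra.
Qed.

(** In the quotient by [G], the faces covering [G] act as vertices and those of the next rank as
    edges. *)
Lemma face_connected (gam k : nat) (Q : {set 'I_m} -> Prop) :
    (forall E S S', is_face E -> is_face S -> is_face S' ->
       gam = (codim E).+1 -> codim S = gam -> codim S' = gam ->
       S \subset E -> S' \subset E -> Q S -> Q S') ->
  forall G S S', is_face G -> codim G = (gam + k)%N ->
    is_face S -> is_face S' -> codim S = gam -> codim S' = gam ->
    G \subset S -> G \subset S' -> Q S -> Q S'.
Proof.
move=> stepQ; elim: k => [|k IHk] G S S' fG cG fS fS' cS cS' sGS sGS'.
  by rewrite -(face_eq fG sGS) ?cG ?cS ?addn0 // -(face_eq fG sGS') // cG cS' addn0.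
have pG T : G \subset T -> codim T = gam -> G \proper T.
  move=> sGT cT; rewrite properEneq sGT andbT; apply/eqP => GT.
  by by move: cG; rewrite GT cT -{1}[gam]addn0 => /addnI.
have [G1 [fG1 sG1 sG1S cG1]] := face_between fG fS (pG _ sGS cS).
have [G0 [fG0 sG0 sG0S' cG0]] := face_between fG fS' (pG _ sGS' cS').
(* The objective is [f / h], defined off [G]; its minimum 0 is attained exactly on [G0]. *)
have [h vh zh] := fG; have [f vf zf] := fG0.
have hG : (h <= ann G)%MS by rewrite -zh valid_ann.
have fGann : (f <= ann G)%MS.
  by apply: submx_trans (annS sG0); rewrite -zf valid_ann.
have h0 j : 0 <= h 0 j by case/validP: vh.
have outside T : codim G = (codim T).+1 -> exists2 j, j \in T & 0 < h 0 j.
  move=> cT; suff /subsetPn[j jT] : ~~ (T \subset G).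
    by rewrite -zh notin_zeros //; exists j.
  by apply/negP => /codimS; rewrite cT ltnn.
have [phi phiE] : exists phi, forall j, j \in G1 -> f 0 j = phi * h 0 j.
  apply: (ann_ratio cG1 sG1 hG _ fGann).
  have [j jG1 hj] := outside _ cG1.
  by apply/negP => /annP[_ /(_ j jG1) E]; rewrite E ltxx in hj.
have codim1 T : codim G = (codim T).+1 -> codim T = (gam + k)%N.
  by rewrite cG addnS => -[].
have {cG1} := codim1 _ cG1; have {cG0} := codim1 _ cG0 => cG0 cG1.
(* Termination: the number of columns strictly better than [G1]. *)
have [N le_N] := ubnP #|[set j | f 0 j < phi * h 0 j]|.
(* Simplex step: unless G1 = G0, [f / h] decreases along some face G2 covering G1,
   and G3 is the other face covering G in G2. *)
elim: N => // N IHN in phi le_N G1 fG1 sG1 cG1 phiE S fS cS sG1S {sGS} *.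
have [/existsP[j0 yj0]|] := boolP [exists j, (f - phi *: h) 0 j < 0].
  have [a va za] := fG1.
  have ya : (f - phi *: h <= ann (zeros a))%MS.
    apply/annP; split.
      case/validP: vf => fA _; case/validP: vh => hA _.
      by rewrite addmx_sub ?eqmx_opp // scalemx_sub.
    by move=> j; rewrite za => /phiE; rewrite !mxE => ->; rewrite subrr.
  have [G2 [t [fG2 sG2 cG2 t0 yE]]] := improving_face va ya yj0.
  have [||G3 [M [fG3 sG3 sG32 cG3 [M0 aE]]]] :=
    @opposite_face G G2 a h va vh zh _ sG2 fG2 _ cG2; rewrite ?za //.
    by rewrite cG1 cG addnS.
  have tM : 0 < t * M by exact: mulr_gt0.
  have fE j : j \in G3 -> f 0 j = (phi - t * M) * h 0 j.
    move=> jG3; have := yE j (subsetP sG32 j jG3); rewrite (aE _ jG3) !mxE; lra.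
  rewrite za in sG2 cG2.
  have lt_N : (#|[set j | (f 0 j < (phi - t * M) * h 0 j)%R]| < N)%N.
    rewrite ltnS in le_N; apply: leq_trans le_N; apply: proper_card.
    apply/properP; split.
      apply/subsetP => j; rewrite !inE => /lt_le_trans; apply.
      by apply: ler_wpM2r => //; rewrite gerBl ltW.
    have [j jG3 hj] := outside _ cG3.
    by exists j; rewrite !inE (fE _ jG3) ?ltxx // ltr_pM2r // gtrBl.
  have cG3' := codim1 _ cG3.
  (* If [G1] has codimension [gam], it equals [S], and [G2] is a common face fit for [stepQ].
     Otherwise some [S2] of codimension [gam] contains [G2], hence both [G1] and [G3], and the outer
     induction at [G1] carries [Q] from [S] to [S2]. *)
  clear codim1; case: k => [|k] in IHk cG cG0 cG1 cG3' IHN *.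
    rewrite addn0 in cG1 cG3'.
    move=> QS; apply: (IHN _ lt_N G3 _ _ _ _ G3) => //; first by rewrite addn0.
    apply: (stepQ G2 S) => //; first by rewrite -cG1.
    by rewrite -(face_eq fG1 sG1S) // cG1 cS.
  have [|S2 [fS2 sG2S2 cS2]] := @face_of_codim G2 gam fG2.
    by rewrite -ltnS -cG2 cG1 addnS ltnS leq_addr.
  move=> QS; apply: (IHN _ lt_N G3 _ _ _ _ S2) => //.
    exact: subset_trans sG32 sG2S2.
  by apply: (IHk G1 S) => //; apply: subset_trans sG2S2.
rewrite negb_exists => /forallP y0.
(* No column improves, so the value on [G1] is the minimum 0. *)
have phi0 : phi = 0.
  have [|j jG0 hj] := outside G0; first by rewrite cG0 cG addnS.
  have [|i iG1 hi] := outside G1; first by rewrite cG1 cG addnS.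
  have /validP[_ /(_ i)] := vf; rewrite (phiE _ iG1) => ge0.
  have := y0 j; rewrite -leNgt !mxE.
  have : j \in zeros f by rewrite zf.
  rewrite inE => /eqP ->; nra.
have eG : G1 = G0.
  apply: face_eq => //; last by rewrite cG1 cG0.
  apply/subsetP => j /phiE; rewrite phi0 mul0r -zf inE => ->; exact: eqxx.
by apply: (IHk G1) => //; rewrite eG.
Qed.

(** * Generation of the valid cone by facets *)

(* Every valid [y] is a nonnegative combination of facet functionals: if [zeros y] is
   not a facet, [y] is a combination of two valid functionals with more zeros. *)
Lemma facet_ind (Q : 'rV[R]_m -> Prop) :
    Q 0 -> (forall y z, valid y -> valid z -> Q y -> Q z -> Q (y + z)) ->
    (forall t y, 0 <= t -> valid y -> Q y -> Q (t *: y)) ->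
    (forall y, valid y -> codim (zeros y) = 1%N -> Q y) ->
  forall y, valid y -> Q y.
Proof.
move=> Q0 QD QZ Qf y; have [k le_k] := ubnP #|~: zeros y|.
elim: k => // k IHk in y le_k * => vy.
case c: (codim (zeros y)) => [|[|r]]; last first.
- have yann := valid_ann vy.
  have : ~~ (ann (zeros y) <= y)%MS.
    by apply/negP => /mxrankS; rewrite -/(codim _) c leqNgt ltnS (leq_trans (rank_leq_row _)).
  case/row_subPn => i; move: (row i _) (row_sub i (ann (zeros y))) => b bann nb.
  have nbann : (- b <= ann (zeros y))%MS by rewrite eqmx_opp.
  have nTy : ~~ ([set: 'I_m] \subset zeros y).
    by apply/negP => /codimS; rewrite c codim_setT.
  have [mu [u [_ uy bu min_u]]] := ratio_min_ann nTy vy bann.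
  have [nu [v [_ vyv bv min_v]]] := ratio_min_ann nTy vy nbann.
  have step (e : R) (d : 'rV_m) w : (d <= ann (zeros y))%MS -> w \notin zeros y ->
      d 0 w = e * y 0 w -> (forall j, j \in [set: 'I_m] -> e * y 0 j <= d 0 j) ->
      valid (d - e *: y) /\ Q (d - e *: y).
    move=> dann wy dw min_w.
    have sz : zeros y \subset zeros (d - e *: y).
      by apply: zeros_subset_ann; rewrite addmx_sub // eqmx_opp scalemx_sub.
    have vd : valid (d - e *: y).
      apply/validP; split.
        case/annP: dann => dA _; case/annP: yann => yA _.
        by rewrite addmx_sub // eqmx_opp scalemx_sub.
      by move=> j; have := min_w j (in_setT _); rewrite !mxE; lra.
    split=> //; apply: IHk => //.
    rewrite ltnS in le_k; apply: leq_trans le_k; apply: proper_card.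
    rewrite properC; apply/properP; split=> //; exists w => //.
    by rewrite inE !mxE dw subrr.
  have [vy1 Qy1] := step _ _ _ bann uy bu min_u.
  have [vy2 Qy2] := step _ _ _ nbann vyv bv min_v.
  have yu : 0 < y 0 u by rewrite -notin_zeros.
  have s0 : 0 <= - (mu + nu).
    by have := min_v u (in_setT _); rewrite !mxE bu; nra.
  (* The two new functionals add up to [- (mu + nu) *: y]; a zero factor would make [b] a multiple
     of [y], against its choice. *)
  have sn0 : - (mu + nu) != 0.
    apply/eqP => e0; case/negP: nb; apply/sub_rVP; exists mu; apply/rowP => j.
    have := min_u j (in_setT _); have := min_v j (in_setT _); rewrite !mxE.
    have -> : nu = - mu by lra.
    by rewrite mulNr lerN2 => le1 le2; apply/eqP; rewrite eq_le le1 le2.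
  have -> : y = (- (mu + nu))^-1 *: ((b - mu *: y) + (- b - nu *: y)).
    have -> : (b - mu *: y) + (- b - nu *: y) = - (mu + nu) *: y.
      by apply/rowP => j; rewrite !mxE; ring.
    by rewrite scalerA mulVf // scale1r.
  by apply: QZ; [rewrite invr_ge0 | exact: validD | exact: QD].
- exact: Qf.
have : (y <= (0 : 'M[R]_m))%MS.
  by apply: submx_trans (valid_ann vy) _; rewrite submx0 -mxrank_eq0 -/(codim _) c.
by rewrite submx0 => /eqP ->.
Qed.

(** * The Boolean interval above a simple face *)

Section SimpleFace.

Variables (k : nat) (S : {set 'I_m}) (a : 'I_k -> 'rV[R]_m).
Hypotheses (faceS : is_face S) (codimS_eq : codim S = k).
Hypotheses (a_valid : forall i, valid (a i)) (Sa : forall i, S \subset zeros (a i))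
  (a_facet : forall i, codim (zeros (a i)) = 1%N)
  (a_all : forall y, valid y -> codim (zeros y) = 1%N -> S \subset zeros y ->
     exists i, zeros y = zeros (a i)).
Implicit Types (J : {set 'I_k}) (c t : 'rV[R]_k).

Let B := \matrix_i a i.

(** A sum of nonnegative vectors vanishes only where all terms do, so this is the intersection of
    the facets in [J]; the empty [J] gives all columns. *)
Definition cell J := zeros (\sum_(i in J) a i).

Lemma in_cell J j : (j \in cell J) = [forall (i | i \in J), a i 0 j == 0].
Proof. by rewrite zeros_sum //; apply: eq_forallb => i; rewrite inE. Qed.

Lemma cell_face J : is_face (cell J).
Proof. by exists (\sum_(i in J) a i) => //; apply: valid_sum. Qed.

Lemma sub_cell J : S \subset cell J.
Proof.
apply/subsetP => j jS; rewrite in_cell; apply/forall_inP => i _.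
by have := subsetP (Sa i) j jS; rewrite inE.
Qed.

Lemma mul_facets c j : (c *m B) 0 j = \sum_i c 0 i * a i 0 j.
Proof. by rewrite mxE; apply: eq_bigr => i _; rewrite mxE. Qed.

(** A sum of valid functionals vanishes on [S] only if each term does, so the decomposition by
    [facet_ind] involves only facets through [S]. *)
Lemma facet_span y : valid y -> S \subset zeros y ->
  exists2 c : 'rV[R]_k, forall i, 0 <= c 0 i & y = c *m B.
Proof.
pose Q y := S \subset zeros y -> exists2 c : 'rV[R]_k, forall i, 0 <= c 0 i & y = c *m B.
move: y; apply: (facet_ind (Q := Q)) => [_|y z vy vz Qy Qz|t y t0 vy Qy|y vy cy].
- by exists 0; rewrite ?mul0mx // => i; rewrite mxE.
- rewrite /Q zerosD // subsetI => /andP[/Qy[c c0 ->] /Qz[e e0 ->]].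
  by exists (c + e); rewrite ?mulmxDl // => i; rewrite mxE addr_ge0.
- have [->|nt0] := eqVneq t 0.
    by exists 0; rewrite ?mul0mx ?scale0r // => i; rewrite mxE.
  rewrite /Q zerosZ // => /Qy[c c0 ->].
  by exists (t *: c); rewrite ?scalemxAl // => i; rewrite mxE mulr_ge0.
move=> /(a_all vy cy)[i zi]; have ai := a_valid i.
have [j ja] : exists j, j \notin zeros (a i).
  have /subsetPn[j _ ja] : ~~ ([set: 'I_m] \subset zeros (a i)); last by exists j.
  by apply/negP => /codimS; rewrite a_facet codim_setT.
have ja0 : 0 < a i 0 j by rewrite -notin_zeros.
have : (ann (zeros (a i)) <= a i)%MS.
  rewrite -(mxrank_leqif_sup (valid_ann ai)).2 -/(codim _) a_facet rank_rV.
  by case: (a i =P 0) => // E; rewrite E mxE ltxx in ja0.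
rewrite -zi => /(submx_trans (valid_ann vy)) /sub_rVP[t yE].
exists (t *: delta_mx 0 i); last by rewrite -scalemxAl -rowE rowK.
have t0 : 0 <= t.
  by case/validP: vy => _ /(_ j); rewrite yE mxE pmulr_lge0.
by move=> l; rewrite !mxE; case: (l == i); rewrite ?mulr1 ?mulr0 //= mulr0n mulr0.
Qed.

Lemma ann_facet_span y : (y <= ann S)%MS -> exists c, y = c *m B.
Proof.
have [s vs zs] := faceS; rewrite -zs => yS.
have [M _ [vM zM]] := dominate_ann vs yS.
have [|c _ cE] := facet_span vM; first by rewrite zM zs.
have [|e _ eE] := facet_span vs; first by rewrite zs.
by exists (c - M *: e); rewrite mulmxBl -scalemxAl -cE -eE; apply/rowP => j; rewrite !mxE; ring.
Qed.

(** Simplicity enters here: [k] facet functionals span [ann S], whose dimension is also [k]. *)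
Lemma facet_free : row_free B.
Proof.
rewrite /row_free eqn_leq rank_leq_row /=.
rewrite -{1}codimS_eq; apply: mxrankS; apply/rV_subP => y.
by move=> /ann_facet_span[c ->]; apply: submxMl.
Qed.

Lemma facet_coord_inj c t : c *m B = t *m B -> c = t.
Proof. exact: (row_free_inj facet_free). Qed.

(** Adding a large multiple of the sum of the [a i] over [J] makes both [y] and [- y] valid without
    touching the coordinates off [J]; these are therefore nonnegative for both signs. *)
Lemma ann_cell J y : (y <= ann (cell J))%MS <->
  exists2 c : 'rV[R]_k, y = c *m B & forall i, i \notin J -> c 0 i = 0.
Proof.
split=> [yJ | [c -> c0]]; last first.
  apply/annP; split.
    rewrite mulmx_sub //; apply/row_subP => i; rewrite rowK.
    by case/validP: (a_valid i).
  move=> j; rewrite in_cell => /forall_inP aj; rewrite mul_facets big1 // => i _.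
  by have [/aj/eqP -> | /c0 ->] := boolP (i \in J); rewrite ?mulr0 ?mul0r.
have [c yE] : exists c, y = c *m B.
  by apply: ann_facet_span; apply: submx_trans yJ (annS (sub_cell J)).
exists c => // i iJ.
have sumE : \sum_(i in J) a i = (\row_i (i \in J)%:R) *m B.
  apply/rowP => j; rewrite mul_facets summxE big_mkcond; apply: eq_bigr => l _.
  by rewrite mxE; case: (l \in J); rewrite ?mul1r ?mul0r.
have vJ : valid (\sum_(i in J) a i) by exact: valid_sum.
have pos (z : 'rV_m) e : z = e *m B -> (z <= ann (cell J))%MS -> 0 <= e 0 i.
  move=> zE zJ; have [M M0 [vM zM]] := dominate_ann vJ zJ.
  have [|f f0 fE] := facet_span vM; first by rewrite zM sub_cell.
  have : f = M *: (\row_i (i \in J)%:R) + e.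
    by apply: facet_coord_inj; rewrite -fE sumE zE mulmxDl scalemxAl.
  by move=> E; have := f0 i; rewrite E !mxE (negPf iJ) mulr0 add0r.
apply/eqP; rewrite eq_le (pos y) // andbT.
have := pos (- y) (- c); rewrite mulNmx -yE eqmx_opp mxE oppr_ge0; exact.
Qed.

Lemma codim_cell J : codim (cell J) = #|J|.
Proof.
(* [P *m B] has the rows [a i] with [i] in [J]. *)
pose P : 'M[R]_(#|J|, k) := rowsub enum_val 1%:M.
have freeP : row_free P.
  apply/row_freeP; exists P^T; apply/matrixP => i l; rewrite !mxE.
  under eq_bigr => p _ do rewrite !mxE.
  rewrite (bigD1 (enum_val i)) //= eqxx mul1r big1 ?addr0.
    by rewrite eq_sym (inj_eq enum_val_inj).
  by move=> p /negPf; rewrite eq_sym => ->; rewrite mul0r.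
have : (ann (cell J) :=: P *m B)%MS.
  apply/eqmxP/andP; split; apply/rV_subP => y.
    case/ann_cell => c -> c0; apply/submxP.
    exists (\row_l c 0 (enum_val l)); rewrite mulmxA; congr (_ *m _).
    apply/rowP => i; rewrite !mxE.
    have [iJ | niJ] := boolP (i \in J); last first.
      rewrite c0 // big1 // => l _; rewrite !mxE.
      case: eqP => [E|]; last by rewrite mulr0.
      by move: niJ; rewrite -E enum_valP.
    rewrite (bigD1 (enum_rank_in iJ i)) //= !mxE enum_rankK_in // eqxx mulr1.
    rewrite big1 ?addr0 // => l nl; rewrite !mxE.
    case: eqP => [E|]; last by rewrite mulr0.
    by case/eqP: nl; apply: enum_val_inj; rewrite enum_rankK_in.
  case/submxP => c ->; apply/ann_cell; exists (c *m P); first by rewrite mulmxA.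
  move=> i niJ; rewrite mxE big1 // => l _; rewrite !mxE.
  case: eqP => [E|]; last by rewrite mulr0.
  by move: niJ; rewrite -E enum_valP.
by move=> eqB; rewrite /codim eqB mxrankMfree ?facet_free //; apply/eqP.
Qed.

(** A functional with nonnegative coordinates vanishes exactly on the cell of their support. *)
Lemma face_cell E : is_face E -> S \subset E -> exists J, E = cell J.
Proof.
move=> [e ve zE]; rewrite -zE => /(facet_span ve)[c c0 eE].
exists [set i | c 0 i != 0]; apply/setP => j.
rewrite in_cell inE eE mul_facets psumr_eq0; last first.
  by move=> i _; rewrite mulr_ge0 //; case/validP: (a_valid i).
rewrite -big_all big_andE; apply: eq_forallb => i /=.
by rewrite mulf_eq0 inE; case: (c 0 i == 0).
Qed.

End SimpleFace.

(** * Vertices in the bounded case *)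

Section Bounded.

Variable h : 'rV[R]_m.
Hypotheses (h_valid : valid h) (h_pos : forall j, 0 < h 0 j).

Lemma face_set0 : is_face set0.
Proof. by exists h => //; apply/setP => j; rewrite !inE gt_eqF. Qed.

(** [G] is an atom of the face lattice, not necessarily a singleton, since several columns may
    represent one point. *)
Definition vertex j :=
  exists G, [/\ is_face G, j \in G & codim set0 = (codim G).+1].

Lemma exists_vertex T : is_face T -> T != set0 -> exists2 u, u \in T & vertex u.
Proof.
move=> fT T0; have p0T : set0 \proper T by rewrite proper0.
have [G [fG _ sGT cG]] := face_between face_set0 fT p0T.
have /set0Pn[u uG] : G != set0.
  by apply/eqP => G0; move: cG; rewrite G0 => /n_Sn.
by exists u; [exact: (subsetP sGT) | exists G].
Qed.

(** The minimizers of [y / h] on [T] form a nonempty face, which contains a vertex. *)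
Lemma min_at_vertex T y : is_face T -> T != set0 -> (y <= A)%MS ->
  exists mu u, [/\ u \in T, vertex u, y 0 u = mu * h 0 u &
    forall j, j \in T -> mu * h 0 j <= y 0 j].
Proof.
move=> fT /set0Pn[j0 jT] yA.
have h0 j : j \notin zeros h by rewrite (notin_zeros _ h_valid).
have nTh : ~~ (T \subset zeros h) by apply/subsetPn; exists j0.
have [mu [v [vT _ yv min_v]]] := ratio_min y nTh h_valid.
have /validP[hA _] := h_valid.
have yhA : (y - mu *: h <= A)%MS by rewrite addmx_sub // eqmx_opp scalemx_sub.
have fT' : is_face (T :&: zeros (y - mu *: h)).
  by apply: face_of_face => // j /min_v/(_ (h0 j)); rewrite !mxE subr_ge0.
have [|u] := exists_vertex fT'.
  by apply/set0Pn; exists v; rewrite !inE vT !mxE yv subrr eqxx.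
rewrite !inE !mxE subr_eq0 => /andP[uT /eqP yu] vu.
by exists mu, u; split=> // j /min_v; apply.
Qed.

Lemma nonneg_on_vertices T y : is_face T -> (y <= A)%MS ->
    (forall j, j \in T -> vertex j -> 0 <= y 0 j) ->
  forall j, j \in T -> 0 <= y 0 j.
Proof.
move=> fT yA y0 j jT; have T0 : T != set0 by apply/set0Pn; exists j.
have [mu [u [uT vu yu min_u]]] := min_at_vertex fT T0 yA.
apply: le_trans (min_u _ jT); rewrite mulr_ge0 ?(ltW (h_pos j)) //.
by have := y0 u uT vu; rewrite yu pmulr_lge0.
Qed.

Lemma zero_on_vertices T y : is_face T -> (y <= A)%MS ->
    (forall j, j \in T -> vertex j -> y 0 j = 0) ->
  forall j, j \in T -> y 0 j = 0.
Proof.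
move=> fT yA y0 j jT; apply/eqP; rewrite eq_le andbC.
apply/andP; split; last rewrite -oppr_ge0.
  by apply: (nonneg_on_vertices fT yA) => // i iT vi; rewrite y0.
have -> : - y 0 j = (- y) 0 j by rewrite mxE.
apply: (nonneg_on_vertices fT) => //; first by rewrite eqmx_opp.
by move=> i iT vi; rewrite mxE y0 // oppr0.
Qed.

Lemma vertex_outside T a : is_face T -> valid a -> ~~ (T \subset zeros a) ->
  exists u, [/\ u \in T, vertex u & 0 < a 0 u].
Proof.
move=> fT va /subsetPn[j jT ja].
have T0 : T != set0 by apply/set0Pn; exists j.
have naA : (- a <= A)%MS by rewrite eqmx_opp; case/validP: va.
have [mu [u [uT vu yu min_u]]] := min_at_vertex fT T0 naA.
exists u; split=> //; rewrite -oppr_lt0; move: yu; rewrite mxE => ->.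
rewrite pmulr_llt0 // -(pmulr_llt0 _ (h_pos j)).
by apply: le_lt_trans (min_u _ jT) _; rewrite mxE oppr_lt0 -(notin_zeros _ va).
Qed.

(** * Generation of the dual cone by vertices *)

(* Up to positive multiples the facet functionals are among these finitely many
   vectors; not all of them are valid. *)
Definition facet_form (p : bool * {set 'I_m}) : 'rV[R]_m :=
  (-1) ^+ p.1 *: nz_row (ann p.2).

Lemma facet_formP y : valid y -> codim (zeros y) = 1%N ->
  exists p t, [/\ 0 <= t, valid (facet_form p) & y = t *: facet_form p].
Proof.
move=> vy cy; set g := nz_row (ann (zeros y)).
have g0 : g != 0 by rewrite nz_row_eq0 -mxrank_eq0 -/(codim _) cy.
have ga : (g <= ann (zeros y))%MS by exact: nz_row_sub.
have : (ann (zeros y) <= g)%MS.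
  by rewrite -(mxrank_leqif_sup ga).2 -/(codim _) cy rank_rV g0.
move=> /(submx_trans (valid_ann vy))/sub_rVP[t yE].
have t0 : t != 0.
  apply/eqP => t0; move: cy; rewrite yE t0 scale0r.
  have -> : zeros (0 : 'rV[R]_m) = [set: 'I_m] by apply/setP => j; rewrite !inE mxE eqxx.
  by rewrite codim_setT.
have [lt0 | gt0] := ltP t 0.
  have E : y = (- t) *: facet_form (true, zeros y).
    by rewrite /facet_form /= expr1 scaleN1r scalerN scaleNr opprK.
  exists (true, zeros y), (- t); split=> //; first by rewrite oppr_ge0 ltW.
  have -> : facet_form (true, zeros y) = (- t)^-1 *: y.
    by rewrite {2}E scalerA mulVf ?scale1r // oppr_eq0.
  by apply: validZ => //; rewrite invr_ge0 oppr_ge0 ltW.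
have E : y = t *: facet_form (false, zeros y) by rewrite /facet_form /= expr0 scale1r.
exists (false, zeros y), t; split=> //.
have -> : facet_form (false, zeros y) = t^-1 *: y.
  by rewrite {2}E scalerA mulVf ?scale1r.
by apply: validZ => //; rewrite invr_ge0.
Qed.

Lemma nonneg_of_facets (w : 'cV[R]_m) :
    (forall p, valid (facet_form p) -> 0 <= (facet_form p *m w) 0 0) ->
  forall y, valid y -> 0 <= (y *m w) 0 0.
Proof.
move=> w0; apply: facet_ind.
- by rewrite mul0mx mxE.
- by move=> y z _ _ y0 z0; rewrite mulmxDl mxE addr_ge0.
- by move=> t y t0 _ y0; rewrite -scalemxAl mxE mulr_ge0.
move=> y vy /(facet_formP vy)[p [t [t0 vp ->]]].
by rewrite -scalemxAl mxE mulr_ge0 // w0.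
Qed.

(** A column vector [w] stands for the point [A *m w]. If it satisfies all facet inequalities, the
    zero set of [tight w] is its minimal face. *)
Definition tight (w : 'cV[R]_m) :=
  \sum_(p | valid (facet_form p) && ((facet_form p *m w) 0 0 == 0)) facet_form p.

Lemma valid_tight w : valid (tight w).
Proof. by apply: valid_sum => p /andP[]. Qed.

Lemma in_tight w j : reflect
  (forall p, valid (facet_form p) -> (facet_form p *m w) 0 0 = 0 ->
     facet_form p 0 j = 0) (j \in zeros (tight w)).
Proof.
rewrite zeros_sum; last by move=> p /andP[].
apply: (iffP forall_inP) => [H p vp wp | H p /andP[vp /eqP wp]].
  by have := H p; rewrite vp wp eqxx inE => /(_ isT)/eqP.
by rewrite inE H.
Qed.

(* Minkowski-Weyl: from a point satisfying all facet inequalities, subtract the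
   largest admissible multiple of a vertex of its minimal face. *)
Lemma vertex_generation (w : 'cV[R]_m) :
    (forall y, valid y -> 0 <= (y *m w) 0 0) ->
  exists w' : 'cV[R]_m, [/\ forall j, 0 <= w' j 0,
    forall j, w' j 0 != 0 -> vertex j &
    forall y, (y <= A)%MS -> (y *m w) 0 0 = (y *m w') 0 0].
Proof.
have [N] := ubnP #|zeros (tight w)|; elim: N => // N IHN in w * => le_N w0.
(* If the minimal face is empty, [tight w] is positive on all columns and zero at [w]. Any
   functional becomes valid after adding a multiple of it, so it is nonnegative at [w]; with both
   signs, all functionals vanish there. *)
have [E0 | nE0] := eqVneq (zeros (tight w)) set0.
  have tw : (tight w *m w) 0 0 = 0.
    by rewrite mulmx_suml summxE big1 // => p /andP[_ /eqP].
  have le0 y : (y <= A)%MS -> 0 <= (y *m w) 0 0.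
    move=> yA; have [|M M0 [vM _]] := @dominate_ann _ y (valid_tight w).
      by apply/annP; split=> // j; rewrite E0 inE.
    by have := w0 _ vM; rewrite mulmxDl -scalemxAl mxE mxE tw mulr0 add0r.
  exists 0; split=> [j|j|y yA]; [by rewrite mxE | by rewrite mxE eqxx |].
  rewrite mulmx0 [RHS]mxE; apply/eqP; rewrite eq_le le0 // andbT -oppr_ge0.
  by have := le0 (- y); rewrite eqmx_opp mulNmx mxE; apply.
have fE : is_face (zeros (tight w)) by exists (tight w) => //; apply: valid_tight.
have [u uE vu] := exists_vertex fE nE0.
(* Otherwise all facet functionals, hence the positive [h], would be nonpositive at [u]. *)
have [p0 [vp0 p0u]] : exists p, valid (facet_form p) /\ 0 < facet_form p 0 u.
  have [/existsP[p /andP[]] | ] :=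
    boolP [exists p, valid (facet_form p) && (0 < facet_form p 0 u)].
    by exists p.
  rewrite negb_exists => /forallP np.
  suff : h 0 u <= 0 by rewrite leNgt h_pos.
  have := h_valid; move: (h); apply: facet_ind.
  - by rewrite mxE.
  - by move=> y z _ _ y0 z0; rewrite mxE; lra.
  - by move=> t y t0 _ y0; rewrite mxE mulr_ge0_le0.
  move=> y vy /(facet_formP vy)[p [t [t0 vp ->]]].
  rewrite mxE mulr_ge0_le0 // leNgt; have := np p.
  by rewrite negb_and vp.
pose P p := valid (facet_form p) && (0 < facet_form p 0 u).
have Pp0 : P p0 by rewrite /P vp0.
(* The facet [p1] of least ratio limits how much of [u] can be removed. It becomes tight and misses
   [u], so the minimal face shrinks. *)
pose r p := (facet_form p *m w) 0 0 / facet_form p 0 u.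
case: (arg_minP r Pp0) => p1 /andP[vp1 p1u] min_p1.
pose t := r p1.
have t0 : 0 <= t by rewrite divr_ge0 ?w0 // ltW.
pose w1 := w - t *: delta_mx u 0.
have w1E y : (y *m w1) 0 0 = (y *m w) 0 0 - t * y 0 u.
  by rewrite mulmxBr -scalemxAr -colE !mxE.
have [||w2 [w20 w2v w2E]] := IHN w1.
- rewrite ltnS in le_N; apply: leq_trans le_N; apply: proper_card.
  apply/properP; split.
    apply/subsetP => j /in_tight jw; apply/in_tight => p vp wp; apply: jw => //.
    by rewrite w1E wp (in_tight _ _ uE) // mulr0 subrr.
  exists u => //; apply/negP => /in_tight/(_ p1 vp1); rewrite w1E /t /r divfK ?gt_eqF //.
  by rewrite subrr => /(_ erefl) E; rewrite E ltxx in p1u.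
- apply: nonneg_of_facets => p vp; rewrite w1E subr_ge0.
  have /validP[_ /(_ u)] := vp; rewrite le_eqVlt => /orP[/eqP <- | pu].
    by rewrite mulr0 w0.
  by rewrite -ler_pdivlMr //; apply: min_p1; rewrite /P vp.
exists (w2 + t *: delta_mx u 0); split.
- by move=> j; rewrite !mxE addr_ge0 // mulr_ge0 // ler0n.
- move=> j; have [-> // | ju] := eqVneq j u.
  by rewrite !mxE (negPf ju) mulr0 addr0; apply: w2v.
move=> y yA; rewrite mulmxDr [RHS]mxE -w2E // w1E -scalemxAr -colE !mxE.
by rewrite subrK.
Qed.

(** * Gluing the local affine functions *)

Section LocalToGlobal.

Variables (k : nat) (q : 'I_m -> R).

Hypothesis simple : forall S, is_face S -> codim S = k.+2 ->
  exists a : 'I_k.+2 -> 'rV[R]_m,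
    [/\ forall i, valid (a i), forall i, S \subset zeros (a i),
        forall i, codim (zeros (a i)) = 1%N &
        forall y, valid y -> codim (zeros y) = 1%N -> S \subset zeros y ->
          exists i, zeros y = zeros (a i)].

Hypothesis q_local : forall T, is_face T -> codim T = k ->
  exists2 l : 'rV[R]_m, (l <= A)%MS &
    forall j, j \in T -> vertex j -> l 0 j = q j.

(* [l] is the function called l_S in the header. *)
Definition good (l : 'rV[R]_m) S := forall T, is_face T -> codim T = k -> S \subset T ->
  forall j, j \in T -> vertex j -> l 0 j = q j.

(* [w i] is a vertex off facet [i] but on all the others, so the values at the [w i]
   are coordinates on [ann S]. *)
Lemma simple_frame S : is_face S -> codim S = k.+2 ->
  exists (a : 'I_k.+2 -> 'rV[R]_m) (w : 'I_k.+2 -> 'I_m),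
    [/\ [/\ forall J, is_face (cell a J), forall J, S \subset cell a J,
            forall J, codim (cell a J) = #|J| &
            forall E, is_face E -> S \subset E -> exists J, E = cell a J],
        forall y, (y <= ann S)%MS -> exists c, y = c *m \matrix_i a i,
        forall i, valid (a i) /\ (a i <= ann S)%MS &
        [/\ forall i (J : {set _}), i \notin J -> w i \in cell a J,
        forall i, vertex (w i), forall i, 0 < a i 0 (w i) &
          forall i l, l != i -> a l 0 (w i) = 0]].
Proof.
move=> fS cS; have [a [va Sa ca a_all]] := simple fS cS.
have cc := codim_cell fS cS va Sa ca a_all.
(* If [a i] vanished on the intersection of the other facets, its own coordinate would be 0 by
   [ann_cell]. *)
have w_ex i : exists u, [/\ vertex u, 0 < a i 0 u & forall l, l != i -> a l 0 u = 0].
  have [|u [uT vu au]] := @vertex_outside (cell a [set~ i]) (a i) (cell_face va _) (va i).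
    apply/negP => sub; have : (a i <= ann (cell a [set~ i]))%MS.
      by apply: submx_trans (annS sub); apply: valid_ann.
    move/(ann_cell fS cS va Sa ca a_all)=> [c ac c0].
    have : delta_mx 0 i = c.
      by apply: (facet_coord_inj fS cS va ca a_all); rewrite -ac -rowE rowK.
    move/rowP/(_ i); rewrite c0 ?inE ?eqxx // mxE !eqxx => /eqP.
    by rewrite oner_eq0.
  exists u; split=> // l li.
  by move: uT; rewrite (in_cell va) => /forall_inP/(_ l); rewrite !inE => /(_ li)/eqP.
have [w wP] := fin_all_exists w_ex.
exists a, w; split=> //.
- split=> //; [exact: cell_face | exact: sub_cell |].
  by move=> E fE; apply: face_cell.
- by move=> y; apply: (ann_facet_span fS).
- by move=> i; split=> //; apply: submx_trans (annS (Sa i)); apply: valid_ann.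
split=> [i J iJ|i|i|i]; try by case: (wP i).
rewrite (in_cell va); apply/forall_inP => l lJ.
by have [_ _ ->] := wP i => //; apply: contraNneq iJ => <-.
Qed.

Lemma mul_frame (a : 'I_k.+2 -> 'rV[R]_m) (w : 'I_k.+2 -> 'I_m)
    (c : 'rV[R]_k.+2) i :
    (forall l, l != i -> a l 0 (w i) = 0) ->
  (c *m \matrix_l a l) 0 (w i) = c 0 i * a i 0 (w i).
Proof.
move=> aw; rewrite mxE (bigD1 i) //= mxE big1 ?addr0 // => l li.
by rewrite mxE aw ?mulr0.
Qed.

Lemma card_setC2 (i l : 'I_k.+2) : i != l -> #|~: [set i; l]| = k.
Proof. by move=> il; rewrite cardsCs setCK cards2 il card_ord subn2. Qed.

(** The local function of one face [T0] is corrected by facet functionals to match [q] at every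
    [w i]. For any other [T = cell a J], the difference from the local function of [T] vanishes on
    [S], and its coordinates off [J] are 0 because those [w i] lie in [T]; what remains vanishes on
    [T]. *)
Lemma good_exists S : is_face S -> codim S = k.+2 ->
  exists2 l : 'rV[R]_m, (l <= A)%MS & good l S.
Proof.
move=> fS cS.
have [a [w [[cf sc cc fc] span va [wc wv aw0 aw]]]] := simple_frame fS cS.
pose T0 := cell a (~: [set 0; 1]).
have cT0 : codim T0 = k by rewrite cc card_setC2.
have [l0 l0A l0q] := q_local (cf _) cT0.
pose c : 'rV[R]_k.+2 := \row_i ((q (w i) - l0 0 (w i)) / a i 0 (w i)).
have cBS : (c *m \matrix_i a i <= ann S)%MS.
  by rewrite mulmx_sub //; apply/row_subP => i; rewrite rowK; case: (va i).
have lA : ((l0 + c *m \matrix_i a i)%R <= A)%MS.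
  by rewrite addmx_sub //; case/annP: cBS.
exists (l0 + c *m \matrix_i a i) => // T fT cT sST.
have [J TJ] := fc _ fT sST.
have [lT lTA lTq] := q_local fT cT.
set l := l0 + _.
have lw i : l 0 (w i) = q (w i).
  rewrite mxE mul_frame; last exact: aw.
  by rewrite [c 0 i]mxE divfK ?gt_eqF // addrC subrK.
have yA : (l - lT <= A)%MS by rewrite addmx_sub // eqmx_opp.
have /span[t yt] : (l - lT <= ann S)%MS.
  apply/annP; split=> //; apply: (zero_on_vertices fS yA) => j jS vj.
  have /annP[_ /(_ j jS) cj] := cBS.
  rewrite mxE [l 0 j]mxE cj addr0 mxE l0q ?lTq ?subrr //.
    exact: (subsetP sST).
  exact: (subsetP (sc _)).
have t0 i : i \notin J -> t 0 i = 0.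
  move=> iJ; have := mul_frame t (aw i); rewrite -yt mxE lw mxE lTq //; last first.
    by rewrite TJ wc.
  by rewrite subrr => /esym/eqP; rewrite mulf_eq0 (gt_eqF (aw0 i)) orbF => /eqP.
move=> j jT vj; rewrite -(lTq j jT vj); apply/eqP; rewrite -subr_eq0.
have -> : l 0 j - lT 0 j = (l - lT) 0 j by rewrite !mxE.
rewrite yt mxE big1 // => i _; rewrite mxE.
have [iJ | /t0 ->] := boolP (i \in J); last by rewrite mul0r.
move: jT; rewrite TJ in_cell; last by move=> l1; case: (va l1).
by move=> /forall_inP/(_ i iJ)/eqP ->; rewrite mulr0.
Qed.

(** [E] is cut out by all facets through [S] except [i0]. Each [T i] contains [E], [w i0] and [w i],
    so [l] and [l'] agree on [S] and at every [w i]. *)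
Lemma good_unique E S (l l' : 'rV[R]_m) : is_face E -> codim E = k.+1 ->
    is_face S -> codim S = k.+2 -> S \subset E ->
    (l <= A)%MS -> (l' <= A)%MS ->
    (forall T, is_face T -> codim T = k -> E \subset T ->
       forall j, j \in T -> vertex j -> l 0 j = l' 0 j) ->
  l = l'.
Proof.
move=> fE cE fS cS sSE lA l'A ll'.
have [a [w [[cf sc cc fc] span va [wc wv aw0 aw]]]] := simple_frame fS cS.
have [J EJ] := fc _ fE sSE.
have [i0 Ji0] : exists i0, J = [set~ i0].
  have /cards1P[i0 JC] : #|~: J| == 1%N.
    by rewrite cardsCs setCK card_ord -cc -EJ cE subSn // subnn.
  by exists i0; rewrite -[J]setCK JC.
pose T i := cell a (~: [set i0; i]).
have ET i : i != i0 -> [/\ is_face (T i), codim (T i) = k & E \subset T i].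
  move=> ii0; rewrite /T; split=> //; first by rewrite cc card_setC2 // eq_sym.
  rewrite EJ Ji0; apply/subsetP => j; rewrite !in_cell; try by move=> l1; case: (va l1).
  move=> /forall_inP aj; apply/forall_inP => p; rewrite !inE negb_or => /andP[pi0 _].
  by apply: aj; rewrite !inE.
have [i1 i10] : exists i1 : 'I_k.+2, i1 != i0.
  by exists (if i0 == 0 then 1 else 0); case: (i0 =P 0) => [->|/eqP] //; rewrite eq_sym.
have lw i : l 0 (w i) = l' 0 (w i).
  have [->|ii0] := eqVneq i i0.
    have [fT cT sET] := ET _ i10.
    by apply: (ll' _ fT) => //; apply: wc; rewrite !inE eqxx.
  have [fT cT sET] := ET _ ii0.
  by apply: (ll' _ fT) => //; apply: wc; rewrite !inE eqxx orbT.
have yA : (l - l' <= A)%MS by rewrite addmx_sub // eqmx_opp.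
have /span[t yt] : (l - l' <= ann S)%MS.
  apply/annP; split=> //; apply: (zero_on_vertices fS yA) => j jS vj.
  have [fT cT sET] := ET _ i10.
  rewrite mxE (ll' _ fT) // ?mxE ?subrr //.
  by apply: (subsetP sET); apply: (subsetP sSE).
apply/eqP; rewrite -subr_eq0 yt; suff -> : t = 0 by rewrite mul0mx.
apply/rowP => i; have := mul_frame t (aw i); rewrite -yt mxE lw mxE subrr => /esym/eqP.
by rewrite mulf_eq0 (gt_eqF (aw0 i)) orbF mxE => /eqP.
Qed.

Theorem affine_of_local : (k.+2 < codim set0)%N ->
  exists2 l : 'rV[R]_m, (l <= A)%MS & forall j, vertex j -> l 0 j = q j.
Proof.
move=> ltk.
have [S0 [fS0 _ cS0]] := face_of_codim face_set0 (ltnW ltk).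
have [l lA gl] := good_exists fS0 cS0.
exists l => // j vj; have [G [fG jG cG]] := vj.
(* The strict bound on [k.+2] is what leaves room for [S] above a vertex. *)
have [|S [fS sGS cS]] := @face_of_codim G k.+2 fG; first by rewrite -ltnS -cG.
have : good l S.
  (* The empty face serves as the common face of [S0] and [S]. *)
  move: gl; apply: (@face_connected k.+2 (codim set0 - k.+2) (good l) _ set0) => //.
  - move=> E S1 S2 fE fS1 fS2 [cE] cS1 cS2 sS1E sS2E gS1.
    have [l2 l2A gl2] := good_exists fS2 cS2.
    suff -> : l = l2 by [].
    apply: (@good_unique E S1) => // T fT cT sET p pT vp.
    by rewrite (gS1 T) ?(gl2 T) //; apply: subset_trans sET.
  - exact: face_set0.
  - by rewrite subnKC // ltnW.
  - exact: sub0set.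
  - exact: sub0set.
have [|T [fT sST cT]] := @face_of_codim S k fS; first by rewrite cS leqW.
by move=> /(_ T fT cT sST); apply=> //; apply: (subsetP sST); apply: (subsetP sGS).
Qed.

End LocalToGlobal.
End Bounded.
End FaceLattice.

(** * Polytopes and homogenization *)

Section Homogenization.

Variables (R : realFieldType) (d : nat).
Implicit Types (u v x : 'rV[R]_d).

Lemma dotDl u v x : dot (u + v) x = dot u x + dot v x.
Proof. by rewrite /dot -big_split; apply: eq_bigr => i _; rewrite !mxE mulrDl. Qed.

Lemma dotZl (t : R) u v : dot (t *: u) v = t * dot u v.
Proof. by rewrite /dot mulr_sumr; apply: eq_bigr => i _; rewrite !mxE mulrA. Qed.

Lemma dotC u v : dot u v = dot v u.
Proof. by apply: eq_bigr => i _; rewrite mulrC. Qed.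

Lemma dotDr u v x : dot x (u + v) = dot x u + dot x v.
Proof. by rewrite dotC dotDl !(dotC x). Qed.

Lemma dotZr (t : R) u v : dot u (t *: v) = t * dot u v.
Proof. by rewrite dotC dotZl dotC. Qed.

Lemma dotNl u v : dot (- u) v = - dot u v.
Proof. by rewrite -scaleN1r dotZl mulN1r. Qed.

Lemma dot_sub_sqr u v : dot (u - v) (u - v) = dot u u - 2 * dot v u + dot v v.
Proof.
by rewrite dotDl !dotDr !dotNl (dotC u (- v)) (dotC v (- v)) !dotNl; ring.
Qed.

Lemma dot_sumr (I : finType) u (w : I -> R) (f : I -> 'rV[R]_d) :
  dot u (\sum_i w i *: f i) = \sum_i w i * dot u (f i).
Proof.
rewrite /dot; under [RHS]eq_bigr => i _ do rewrite mulr_sumr.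
rewrite exchange_big; apply: eq_bigr => j _ /=.
by rewrite summxE mulr_sumr; apply: eq_bigr => i _; rewrite mxE mulrCA.
Qed.

Lemma dot_delta i v : dot (delta_mx 0 i) v = v 0 i.
Proof.
rewrite /dot (bigD1 i) //= mxE !eqxx mul1r big1 ?addr0 // => j /negPf ji.
by rewrite mxE ji andbF mul0r.
Qed.

Lemma dot_ge0 v : 0 <= dot v v.
Proof. by apply: sumr_ge0 => i _; apply: sqr_ge0. Qed.

Lemma dot_eq0 v : dot v v = 0 -> v = 0.
Proof.
move=> /eqP; rewrite psumr_eq0 => [/allP H|i _]; last exact: sqr_ge0.
apply/rowP => i; have := H i (mem_index_enum i).
by rewrite mulf_eq0 orbb mxE => /eqP.
Qed.

Definition homog N (f : 'I_N -> 'rV[R]_d) : 'M[R]_(N, 1 + d) :=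
  \matrix_i row_mx 1 (f i).

Lemma mul_homog N (f : 'I_N -> 'rV[R]_d) (c : 'rV[R]_N) :
  c *m homog f = row_mx (\sum_i c 0 i)%:M (\sum_i c 0 i *: f i).
Proof.
rewrite mulmx_sum_row; under eq_bigr => i _ do rewrite rowK scale_row_mx.
rewrite -[LHS]hsubmxK; congr row_mx.
  rewrite [LHS]raddf_sum; under eq_bigr => i _ do rewrite /= row_mxKl.
  by rewrite -scaler_suml; apply: scalemx1.
by rewrite raddf_sum; apply: eq_bigr => i _; rewrite /= row_mxKr.
Qed.

Lemma row_free_mul0 (p r : nat) (M : 'M[R]_(p, r)) :
  (forall c : 'rV_p, c *m M = 0 -> c = 0) <-> row_free M.
Proof.
split=> [H | fM c /eqP]; last by rewrite mulmx_free_eq0 // => /eqP.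
rewrite -kermx_eq0 -submx0; apply/rV_subP => c /sub_kermxP/H ->.
exact: sub0mx.
Qed.

(** In a dependence of homogenized points the coefficients sum to zero, so the first is determined
    by the others, which form a dependence of the differences from the first point. *)
Lemma aff_indep_homog N (f : 'I_N -> 'rV[R]_d) :
  aff_indep [seq f i | i <- enum 'I_N] = row_free (homog f).
Proof.
case: N => [|N] in f *.
  have -> : enum 'I_0 = [::] by apply: size0nil; rewrite size_enum_ord.
  by rewrite /row_free -leqn0 rank_leq_row.
rewrite enum_ordSl /= -map_comp -map_comp.
pose g (i : 'I_N) := f (lift ord0 i) - f ord0.
rewrite (_ : [seq _ | i <- _] = [tuple g i | i < N]) //.
have sumE (c : 'rV[R]_N.+1) : \sum_i c 0 i = 0 ->
    \sum_i c 0 i *: f i = \sum_(i < N) c 0 (lift ord0 i) *: g i.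
  rewrite !big_ord_recl => /eqP; rewrite addr_eq0 => /eqP ->.
  rewrite /g; under [RHS]eq_bigr => i _ do rewrite scalerBr.
  by rewrite sumrB -scaler_suml scaleNr addrC.
apply/idP/idP => [/freeP H | /row_free_mul0 H].
  apply/row_free_mul0 => c; rewrite mul_homog => /eqP; rewrite row_mx_eq0.
  case/andP=> /eqP s0 /eqP; have {}s0 : \sum_i c 0 i = 0.
    by have /matrixP/(_ 0 0) := s0; rewrite !mxE eqxx mulr1n.
  rewrite sumE // => g0.
  have cl i : c 0 (lift ord0 i) = 0.
    apply: (H (fun i => c 0 (lift ord0 i))); rewrite -[RHS]g0.
    by apply: eq_bigr => l _; rewrite -tnth_nth tnth_mktuple.
  apply/rowP => i; rewrite mxE; case: (unliftP ord0 i) => [l|] ->; first exact: cl.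
  by move: s0; rewrite big_ord_recl big1 ?addr0.
apply/freeP => k kg i.
pose c : 'rV[R]_N.+1 := \row_l if unlift ord0 l is Some l' then k l' else - \sum_l' k l'.
have cl l : c 0 (lift ord0 l) = k l by rewrite mxE liftK.
have s0 : \sum_l c 0 l = 0.
  rewrite big_ord_recl mxE unlift_none; under [X in _ + X]eq_bigr => l _ do rewrite cl.
  by rewrite addNr.
rewrite -cl (H c) ?mxE // mul_homog s0 sumE //.
under eq_bigr => l _ do rewrite cl.
rewrite (_ : \sum_(l < N) _ = 0) ?raddf0 ?row_mx0 //.
rewrite -[RHS]kg; apply: eq_bigr => l _.
by rewrite -tnth_nth tnth_mktuple.
Qed.

End Homogenization.

(** * Faces of a convex hull as index sets *)

Section Hull.

Variables (R : realFieldType) (d : nat) (V : seq 'rV[R]_d).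
Local Notation m := (size V).
Implicit Types (x a : 'rV[R]_d) (y : 'rV[R]_m) (S : {set 'I_m}) (j : 'I_m).

Definition pt j := V`_j.

Definition evals : 'M[R]_(1 + d, m) := (homog pt)^T.

Lemma evals_col j : col j evals = (row_mx 1 (pt j))^T.
Proof. by rewrite -tr_row rowK. Qed.

Lemma mul_evals b a j : (row_mx b%:M a *m evals) 0 j = b + dot a (pt j).
Proof.
have -> : (row_mx b%:M a *m evals) 0 j = (row_mx b%:M a *m col j evals) 0 0.
  by rewrite colE mulmxA -colE [RHS]mxE.
rewrite evals_col tr_row_mx mul_row_col mxE trmx1 mulmx1 mxE eqxx mulr1n.
by rewrite mxE; congr (_ + _); apply: eq_bigr => i _; rewrite mxE.
Qed.

Lemma evalsP y :
  (y <= evals)%MS <-> exists b a, forall j, y 0 j = b + dot a (pt j).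
Proof.
split=> [/submxP[u ->] | [b [a yE]]]; last first.
  have -> : y = row_mx b%:M a *m evals by apply/rowP => j; rewrite mul_evals.
  exact: submxMl.
exists (lsubmx u 0 0), (rsubmx u) => j.
rewrite -mul_evals -mx11_scalar hsubmxK //.
Qed.

Lemma combo_eval y b a (w : 'I_m -> R) :
    (forall j, y 0 j = b + dot a (pt j)) -> \sum_i w i = 1 ->
  \sum_i w i * y 0 i = b + dot a (\sum_i w i *: pt i).
Proof.
move=> yE w1; under eq_bigr => i _ do rewrite yE mulrDr.
by rewrite big_split -mulr_suml w1 mul1r dot_sumr.
Qed.

(** Weights run over the whole list and vanish off [S], so hulls of different index sets compare
    without forming sublists. *)
Definition hull S : pset R d := fun x => exists w : 'I_m -> R,
  [/\ forall i, 0 <= w i, \sum_i w i = 1, x = \sum_i w i *: pt i &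
      forall i, i \notin S -> w i = 0].

Lemma hull_conv S x : hull S x -> conv V x.
Proof. by case=> w [w0 w1 xE _]; exists w. Qed.

Lemma pt_hull S j : j \in S -> hull S (pt j).
Proof.
move=> jS; exists (fun i => (i == j)%:R); split=> [i||| i].
- exact: ler0n.
- by rewrite (bigD1 j) //= eqxx big1 ?addr0 // => i /negPf ->.
- rewrite (bigD1 j) //= eqxx scale1r big1 ?addr0 // => i /negPf ->.
  by rewrite scale0r.
by case: eqP => // ->; rewrite jS.
Qed.

Lemma hullT x : hull [set: 'I_m] x <-> conv V x.
Proof.
split; first exact: hull_conv.
by case=> w [w0 w1 xE]; exists w; split=> // i; rewrite inE.
Qed.

(** A convex combination of nonnegative values is 0 only if all weight sits on [zeros y]. *)
Lemma face_hullE y b a : (forall j, 0 <= y 0 j) ->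
    (forall j, y 0 j = b - dot a (pt j)) ->
  forall x, conv V x /\ dot a x = b <-> hull (zeros y) x.
Proof.
move=> y0 yE x; have yE' j : y 0 j = b + dot (- a) (pt j) by rewrite yE dotNl.
split=> [[[w [w0 w1 xE]] ax] | [w [w0 w1 xE wS]]].
  exists w; split=> // i; rewrite inE => yi.
  have := combo_eval yE' w1; rewrite -xE dotNl ax subrr => /eqP.
  rewrite psumr_eq0 => [/allP/(_ i (mem_index_enum i))|l _]; last exact: mulr_ge0.
  by rewrite mulf_eq0 (negPf yi) orbF => /eqP.
split; first by exists w.
have := combo_eval yE' w1; rewrite -xE dotNl big1 => [/eqP|i _].
  by rewrite eq_sym subr_eq0 => /eqP.
have [/wS -> | ] := boolP (i \notin zeros y); first by rewrite mul0r.
by rewrite negbK inE => /eqP ->; rewrite mulr0.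
Qed.

Lemma face_hull F : face (conv V) F ->
  exists2 y, valid evals y & forall x, F x <-> hull (zeros y) x.
Proof.
move=> [a [b [Pab FE]]]; pose y : 'rV[R]_m := \row_j (b - dot a (pt j)).
have y0 j : 0 <= y 0 j.
  rewrite mxE subr_ge0; apply: Pab; apply/hullT; apply: pt_hull.
  by rewrite inE.
exists y; last first.
  move=> x; rewrite FE; apply: face_hullE => // j; by rewrite mxE.
apply/validP; split=> //; apply/evalsP; exists b, (- a) => j.
by rewrite mxE dotNl.
Qed.

Lemma hull_face S : is_face evals S -> face (conv V) (hull S).
Proof.
move=> [y /validP[/evalsP[b [a yE]] y0] <-].
have yE' j : y 0 j = b - dot (- a) (pt j) by rewrite dotNl opprK.
exists (- a), b; split=> [x [w [w0 w1 xE]]|x]; last first.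
  by rewrite (face_hullE y0 yE').
rewrite dotNl -subr_ge0 opprK xE -(combo_eval yE w1).
by apply: sumr_ge0 => i _; apply: mulr_ge0.
Qed.

(** Recovers indices from a facet known only as a set of points. *)
Lemma hull_zeros y j : valid evals y -> hull (zeros y) (pt j) -> y 0 j = 0.
Proof.
move=> /validP[/evalsP[b [a yE]] y0] H.
have yE' i : y 0 i = b - dot (- a) (pt i) by rewrite dotNl opprK.
have [_ e] := (face_hullE y0 yE' (pt j)).2 H.
by rewrite yE' e subrr.
Qed.

Lemma mul_indicator_homog S (g : 'I_m -> R) : (forall i, i \notin S -> g i = 0) ->
  (\row_i g i) *m (indicator R S *m homog pt) =
  row_mx (\sum_i g i)%:M (\sum_i g i *: pt i).
Proof.
move=> gS; rewrite mulmxA; have -> : \row_i g i *m indicator R S = \row_i g i.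
  apply/rowP => i; rewrite mul_mx_diag !mxE.
  by have [_ | /gS ->] := boolP (i \in S); rewrite ?mulr1 ?mul0r.
rewrite mul_homog; under eq_bigr => i _ do rewrite mxE.
by under [X in row_mx _ X]eq_bigr => i _ do rewrite mxE.
Qed.

Lemma rank_evals S :
  \rank (evals *m indicator R S) = \rank (indicator R S *m homog pt).
Proof. by rewrite -[RHS]mxrank_tr trmx_mul tr_diag_mx. Qed.

Lemma hull_homog S x : hull S x -> (row_mx 1 x <= indicator R S *m homog pt)%MS.
Proof.
case=> w [w0 w1 -> wS]; apply/submxP; exists (\row_i w i).
by rewrite mul_indicator_homog // w1.
Qed.

Lemma size_aff_indep S s : (forall x, x \in s -> hull S x) -> aff_indep s ->
  (size s <= \rank (evals *m indicator R S))%N.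
Proof.
move=> sS; pose f (i : 'I_(size s)) := s`_i.
have -> : s = [seq f i | i <- enum 'I_(size s)].
  rewrite /f (map_comp (fun i => s`_i) val) val_enum_ord.
  by rewrite -/(mkseq _ _) mkseq_nth.
rewrite aff_indep_homog size_map size_enum_ord rank_evals => /eqP {1}<-.
apply: mxrankS; apply/row_subP => i; rewrite rowK; apply: hull_homog.
by apply: sS; apply: mem_nth.
Qed.

(** Maximal independent rows of the masked homogenization; rows off [S] are zero and cannot be
    chosen. *)
Lemma aff_indep_basis S : exists s, [/\ size s = \rank (evals *m indicator R S),
  forall x, x \in s -> hull S x & aff_indep s].
Proof.
rewrite rank_evals; set B := indicator R S *m homog pt.
pose g := maxrankfun B; have freeB : row_free (rowsub g B) by exact: maxrowsub_free.
have rowB j : row j B = (j \in S)%:R *: row_mx 1 (pt j).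
  by rewrite row_mul row_diag_mx mxE -scalemxAl -rowE rowK.
have gS i : g i \in S.
  apply: contraT => giS; have := row_free_mul0 (rowsub g B).
  have e0 : row i (rowsub g B) = 0.
    by rewrite row_rowsub rowB (negPf giS) scale0r.
  move=> [_ /(_ freeB (delta_mx 0 i))]; rewrite -rowE => /(_ e0) /rowP/(_ i).
  by rewrite !mxE !eqxx => /eqP; rewrite oner_eq0.
exists [seq pt (g i) | i <- enum 'I_(\rank B)]; split.
- by rewrite size_map size_enum_ord.
- by move=> x /mapP[i _ ->]; apply: pt_hull.
rewrite (aff_indep_homog (pt \o g)); congr row_free: freeB.
by apply/row_matrixP => i; rewrite row_rowsub rowB gS scale1r rowK.
Qed.

Lemma has_dim_hull S r :
  has_dim (hull S) r <-> \rank (evals *m indicator R S) = r.+1.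
Proof.
have [s [size_s sS fs]] := aff_indep_basis S.
split=> [[[s' [size_s' s'S fs'] max]] | rk]; last first.
  split; first by exists s; rewrite size_s.
  by move=> s' s'S /(size_aff_indep s'S); rewrite rk.
apply/eqP; rewrite eqn_leq -{1}size_s max // -size_s'.
exact: size_aff_indep.
Qed.

Lemma rank_codim S :
  (\rank (evals *m indicator R S) + codim evals S)%N = \rank evals.
Proof. exact: mxrank_mul_ker. Qed.

Lemma has_dim_eqv (F G : pset R d) r :
  (forall x, F x <-> G x) -> has_dim F r -> has_dim G r.
Proof.
move=> FG [[s [ss sF fs]] max]; split; first by exists s; split=> // x /sF/FG.
by move=> s' s'G; apply: max => x /s'G/FG.
Qed.

End Hull.

(** * Extreme points and combinatorial vertices *)

Lemma face_open_segment (R : realFieldType) (d : nat) (P F : pset R d) x y z (t : R) :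
    face P F -> F x -> P y -> P z -> 0 < t -> t < 1 ->
  x = t *: y + (1 - t) *: z -> F y /\ F z.
Proof.
move=> [a [b [Pab FE]]] /FE[Px ax] Py Pz t0 t1 xE.
have ay := Pab _ Py; have az := Pab _ Pz.
move: ax; rewrite xE dotDr !dotZr => e.
have yb : dot a y = b by apply/eqP; rewrite eq_le ay /=; nra.
have zb : dot a z = b by apply/eqP; rewrite eq_le az /=; nra.
by split; apply/FE.
Qed.

Lemma extreme_of_face (R : realFieldType) (d : nat) (P F : pset R d) x :
  face P F -> extreme F x <-> F x /\ extreme P x.
Proof.
move=> fF; have sFP y : F y -> P y by case: fF => [a [b [_ FE]]] /FE[].
split=> [[Fx ex] | [Fx [_ ex]]]; split=> //.
  split; first exact: sFP.
  move=> y z t Py Pz t0 t1 xE.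
  have [Fy Fz] := face_open_segment fF Fx Py Pz t0 t1 xE.
  exact: ex xE.
by move=> y z t /sFP Py /sFP Pz; apply: ex.
Qed.

Lemma inscribed_face (R : realFieldType) (d : nat) (P F : pset R d) :
  face P F -> inscribed P -> inscribed F.
Proof.
move=> fF [c [r [r0 Pr]]]; exists c, r; split=> // v /(extreme_of_face _ fF)[_].
exact: Pr.
Qed.

Section Vertices.

Variables (R : realFieldType) (d : nat) (V : seq 'rV[R]_d).
Local Notation m := (size V).
Local Notation A := (evals V).
Local Notation pt := (pt (V := V)).
Implicit Types (j : 'I_m) (G S T : {set 'I_m}) (x : 'rV[R]_d).

Definition ones : 'rV[R]_m := const_mx 1.

Lemma valid_ones : valid A ones.
Proof.
apply/validP; split=> [|j]; last by rewrite mxE ler01.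
apply/evalsP; exists 1, 0 => j.
by rewrite mxE -[0 : 'rV_d](scale0r 0) dotZl mul0r addr0.
Qed.

Lemma ones_gt0 j : 0 < ones 0 j.
Proof. by rewrite mxE ltr01. Qed.

Lemma coord_evals (l : 'I_d) : (\row_j pt j 0 l <= A)%MS.
Proof.
by apply/evalsP; exists 0, (delta_mx 0 l) => j; rewrite mxE dot_delta add0r.
Qed.

Lemma codim_set0 : codim A set0 = \rank A.
Proof.
rewrite -(rank_codim (V := V) set0) (_ : indicator R set0 = 0) ?mulmx0 ?mxrank0 //.
apply/matrixP => i j; rewrite !mxE inE; case: (i == j); by rewrite ?mulr0n ?mulr1n.
Qed.

(** On an atom every affine function is a multiple of the constant 1, in particular each
    coordinate. *)
Lemma vertex_face_eq G i j : codim A set0 = (codim A G).+1 ->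
  i \in G -> j \in G -> pt i = pt j.
Proof.
move=> cG iG jG; have /validP[oA _] := valid_ones.
have ann0 (y : 'rV_m) : (y <= A)%MS -> (y <= ann A set0)%MS.
  by move=> yA; apply/annP; split=> // l; rewrite inE.
apply/rowP => l.
have [|phi phiE] := ann_ratio cG (sub0set _) (ann0 _ oA) _ (ann0 _ (coord_evals l)).
  apply/negP => /annP[_ /(_ i iG)] => E.
  by have := ones_gt0 i; rewrite E ltxx.
by have := phiE _ iG; have := phiE _ jG; rewrite !mxE => -> ->.
Qed.

Lemma vertex_extreme j : vertex A j -> extreme (conv V) (pt j).
Proof.
move=> [G [fG jG cG]].
have hG x : hull G x -> x = pt j.
  move=> [w [w0 w1 -> wG]]; rewrite -[RHS]scale1r -w1 scaler_suml.
  apply: eq_bigr => i _; have [iG | /wG ->] := boolP (i \in G); last by rewrite !scale0r.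
  by rewrite (vertex_face_eq cG iG jG).
have Gj := pt_hull jG; split; first exact: hull_conv Gj.
move=> y z t Py Pz t0 t1 xE.
by have [/hG -> /hG ->] := face_open_segment (hull_face fG) Gj Py Pz t0 t1 xE.
Qed.

(** [vertex_generation] shifts all weight to vertices; by extremality the point equals any vertex of
    positive weight. *)
Lemma extreme_vertex x : extreme (conv V) x -> exists2 j, vertex A j & x = pt j.
Proof.
case=> [[w [w0 w1 xE]] ex].
have mul_col (u : 'cV[R]_m) (y : 'rV_m) : (y *m u) 0 0 = \sum_i y 0 i * u i 0.
  by rewrite mxE.
have [|u [u0 uv uE]] := @vertex_generation _ _ _ A ones valid_ones ones_gt0 (\col_i w i).
  move=> y /validP[_ y0]; rewrite mul_col; apply: sumr_ge0 => i _.
  by rewrite mxE mulr_ge0.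
have u1 : \sum_i u i 0 = 1.
  have /validP[/uE] := valid_ones; rewrite !mul_col.
  under eq_bigr => i _ do rewrite !mxE mul1r.
  by rewrite w1 => -> _; apply: eq_bigr => i _; rewrite mxE mul1r.
have {}xE : x = \sum_i u i 0 *: pt i.
  rewrite xE; apply/rowP => l; have := uE _ (coord_evals l); rewrite !mul_col !summxE.
  under eq_bigr => i _ do rewrite !mxE mulrC.
  under [RHS in _ = RHS -> _]eq_bigr => i _ do rewrite mxE mulrC.
  move=> e; rewrite (eq_bigr (fun i => w i * pt i 0 l)) ?e => [|i _]; last by rewrite mxE.
  by apply: eq_bigr => i _; rewrite mxE.
have [j uj] : exists j, 0 < u j 0.
  have [/existsP //|] := boolP [exists j, 0 < u j 0].
  rewrite negb_exists => /forallP un; move: u1; rewrite big1 => [/eqP|i _].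
    by rewrite eq_sym oner_eq0.
  by apply/eqP; rewrite eq_le u0 leNgt un.
exists j; first by apply: uv; rewrite gt_eqF.
move: u1 xE; rewrite (bigD1 j) //= [in X in _ -> X -> _](bigD1 j) //=.
set s := u j 0 => u1 xE.
have s1 : \sum_(i < m | i != j) u i 0 = 1 - s by rewrite -u1 addrC addrK.
have : 0 <= 1 - s by rewrite -s1 sumr_ge0.
rewrite le_eqVlt => /orP[/eqP e | lt1].
  rewrite xE big1 => [|i ij]; first by rewrite (_ : s = 1) ?scale1r ?addr0 //; lra.
  move/eqP: s1; rewrite -e psumr_eq0 // => /allP/(_ i (mem_index_enum i)).
  by rewrite ij => /eqP ->; rewrite scale0r.
(* The remainder after splitting off [pt j], renormalized. *)
pose z := \sum_i (if i == j then 0 else u i 0 / (1 - s)) *: pt i.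
have xz : x = s *: pt j + (1 - s) *: z.
  rewrite xE /z [in RHS](bigD1 j) //= eqxx scale0r add0r scaler_sumr.
  congr (_ + _); apply: eq_bigr => i /negPf ->.
  by rewrite scalerA mulrC divfK // gt_eqF.
have Pz : conv V z.
  exists (fun i => if i == j then 0 else u i 0 / (1 - s)); split=> [i||//].
    by case: ifP => // _; rewrite divr_ge0 // ltW.
  rewrite (bigD1 j) //= eqxx add0r -[RHS](@mulfV _ (1 - s)) ?gt_eqF // -[in RHS]s1.
  by rewrite mulr_suml; apply: eq_bigr => i /negPf ->; rewrite s1.
have Pj : conv V (pt j) by apply/hullT/pt_hull; rewrite inE.
have jz : pt j = z by apply: (ex _ _ s) => //; rewrite -subr_gt0.
by rewrite xz -jz -scalerDl addrC subrK scale1r.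
Qed.

End Vertices.

Theorem theorem4p10 (R : realFieldType) (d k : nat) (V : seq 'rV[R]_d) :
  (1 <= k)%N -> (k <= d - 1)%N ->
  has_dim (conv V) d ->
  k_simple (conv V) k ->
  inscribed (conv V) <->
  (forall F : pset R d, face (conv V) F -> has_dim F (d - k + 1) -> inscribed F).
Proof.
move=> k1 kd dimP simpleP; split=> [inP F fF _ | inF]; first exact: inscribed_face inP.
(* From here [k] is one less than in the statement: simplicity concerns codimension [k.+2],
   inscribed faces codimension [k]. *)
case: k => // k in k1 kd simpleP inF *.
pose A := evals V.
have rA : \rank A = d.+1.
  have : has_dim (hull [set: 'I_(size V)]) d.
    by apply: has_dim_eqv dimP => x; apply: iff_sym; apply: hullT.
  by move/has_dim_hull; rewrite -(rank_codim (V := V) [set: _]) codim_setT addn0.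
have rc S : (\rank (A *m indicator R S) + codim A S)%N = d.+1.
  by rewrite rank_codim.
have codim_facet F S : (forall x, F x <-> hull S x) -> has_dim F d.-1 -> codim A S = 1%N.
  move=> FS /(has_dim_eqv FS)/has_dim_hull; have := rc S; rewrite -/A.
  move: kd; clear; lia.
have simple S : is_face A S -> codim A S = k.+2 ->
  exists a : 'I_k.+2 -> 'rV[R]_(size V),
    [/\ forall i, valid A (a i), forall i, S \subset zeros (a i),
        forall i, codim A (zeros (a i)) = 1%N &
        forall y, valid A y -> codim A (zeros y) = 1%N -> S \subset zeros y ->
          exists i, zeros y = zeros (a i)].
  move=> fS cS.
  have [|f [_ fP f_all]] := simpleP _ (hull_face fS).
    apply/has_dim_hull; have := rc S; rewrite cS -/A; move: kd; clear; lia.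
  have a_ex i : exists a : 'rV[R]_(size V),
      valid A a /\ forall x, f i x <-> hull (zeros a) x.
    by have [[/face_hull[a va fa] _] _] := fP i; exists a.
  have [a aP] := fin_all_exists a_ex.
  exists a; split=> [i|i|i|y vy cy Sy].
  - by case: (aP i).
  - have [va fa] := aP i; apply/subsetP => j /pt_hull/((fP i).2 _)/fa.
    by move=> /(hull_zeros va) e; rewrite inE e.
  - have [va fa] := aP i; apply: (codim_facet (f i)) => //.
    by case: (fP i) => [[]].
  have fy : facet (conv V) (hull (zeros y)).
    split; first by apply: hull_face; exists y.
    apply/has_dim_hull; have := rc (zeros y); rewrite cy -/A; move: kd; clear; lia.
  have [|i iE] := f_all _ fy.
    move=> x [w [w0 w1 xE wS]]; exists w; split=> // i iy; apply: wS.
    by apply: contra iy; apply: (subsetP Sy).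
  have [va fa] := aP i; exists i; apply/setP => j; apply/idP/idP.
    by move=> /pt_hull/iE/fa/(hull_zeros va) e; rewrite inE e.
  by move=> /pt_hull/fa/iE/(hull_zeros vy) e; rewrite inE e.
pose q (j : 'I_(size V)) := dot (pt j) (pt j).
have q_local T : is_face A T -> codim A T = k ->
    exists2 l : 'rV[R]_(size V), (l <= A)%MS &
      forall j, j \in T -> vertex A j -> l 0 j = q j.
  move=> fT cT; have [|c [r [_ cr]]] := inF _ (hull_face fT).
    apply/has_dim_hull; have := rc T; rewrite cT -/A; move: kd; clear; lia.
  exists (\row_j (r - dot c c + dot (2 *: c) (pt j))).
    by apply/evalsP; exists (r - dot c c), (2 *: c) => j; rewrite mxE.
  move=> j jT vj; have : extreme (hull T) (pt j).
    apply/(extreme_of_face _ (hull_face fT)); split; first exact: pt_hull.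
    exact: vertex_extreme.
  by move=> /cr <-; rewrite mxE /q dot_sub_sqr dotZl; ring.
have [|l /evalsP[b [a lE]] lq] := affine_of_local (valid_ones V) (@ones_gt0 _ _ V) simple q_local.
  rewrite codim_set0 rA; move: kd; clear; lia.
(* Completing the square in [dot p p = b + dot a p]; [r] is the squared radius. *)
pose c := 2^-1 *: a; pose r := b + dot c c.
have on_sphere j : vertex A j -> dot (pt j - c) (pt j - c) = r.
  move=> vj; have := lq j vj; rewrite lE /q /r => e.
  by rewrite dot_sub_sqr -e [dot c (pt j)]dotZl; field.
have [u vu] : exists u, vertex A u.
  have [|u _ vu] := exists_vertex (valid_ones V) (@ones_gt0 _ _ V) (face_setT A).
    apply/eqP => e; have := codim_setT A; rewrite e codim_set0 rA //.
  by exists u.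
have [G [fG uG cG]] := vu; have [g vg zg] := fG.
have [|v [_ vv gv]] := vertex_outside (valid_ones V) (@ones_gt0 _ _ V) (face_setT A) vg.
  apply/negP => /(codimS A); rewrite codim_setT zg leqn0 => /eqP e.
  by move: cG; rewrite e codim_set0 rA => -[]; move: kd; clear; lia.
(* Radius 0 would place all vertices at [c], but [g] vanishes at [u] and is positive at [v]. *)
have r0 : 0 < r.
  rewrite lt0r -{2}(on_sphere u vu) dot_ge0 andbT; apply/eqP => r0.
  have ctr j : vertex A j -> pt j = c.
    by move=> /on_sphere; rewrite r0 => /dot_eq0/eqP; rewrite subr_eq0 => /eqP.
  have /validP[/evalsP[b' [a' gE]] _] := vg.
  have : u \in zeros g by rewrite zg.
  by rewrite inE gE (ctr u vu) -(ctr v vv) -gE gt_eqF.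
exists c, r; split=> // x /extreme_vertex[j vj ->].
exact: on_sphere.
Qed.
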